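(* Let $\mathrm{A}$ and $\mathrm{B}$ be disjoint finite alphabets of modalities, let $L_1$ be a canonical normal logic over $\mathrm{A}$ and $L_2$ a canonical normal logic over $\mathrm{B}$, and assume that $L_1$ and $L_2$ both admit the finite height criterion. Then $L_1\oplus L_2$ admits the finite height criterion.
   Context: Formulas over a finite alphabet $\mathrm{Al}$ of unary modalities; normal logic over $\mathrm{Al}$: contains all tautologies, $\neg\Diamond\bot$, $\Diamond(p_0\vee p_1)\to\Diamond p_0\vee\Diamond p_1$ for $\Diamond\in\mathrm{Al}$, closed under modus ponens, substitution, monotonicity. An extension of $L$ is a normal logic over the same alphabet containing $L$. For $\mathrm{C}\subseteq\mathrm{Al}$, $L^{\restriction\mathrm C}$ is the set of formulas over $\mathrm C$ belonging to $L$. $L$ is $k$-finite if it has finitely many pairwise nonequivalent formulas in $p_0,\dots,p_{k-1}$, locally tabular if $k$-finite for all $k<\omega$. With $\Diamond_{\mathrm C}\varphi=\bigvee_{\Diamond\in\mathrm C}\Diamond\varphi$ ($\bot$ if $\mathrm C=\emptyset$) and $\Diamond^{\le m}_{\mathrm C}\varphi=\bigvee_{i\le m}\Diamond_{\mathrm C}^i\varphi$, a logic $L$ over $\mathrm C$ is $m$-transitive if it contains $\Diamond_{\mathrm C}^{m+1}p\to\Diamond_{\mathrm C}^{\le m}p$; $\mathrm{tra}(L)$ is the least such $m$ ($\omega$ if none). If $\mathrm{tra}(L)=m<\omega$, put $\Diamond^*=\Diamond^{\le m}_{\mathrm C}$; let $B_0=\bot$, $B_h=p_h\to\Box(\Diamond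 p_h\vee B_{h-1})$, and $B_h^*$ the result of replacing $\Diamond,\Box$ by $\Diamond^*,\neg\Diamond^*\neg$. The height $h(L)$ is the least $h$ with $B^*_h\in L$, or $\omega$ if none exists or $L$ is not pretransitive. A logic $L_0$ over $\mathrm{Al}$ admits the finite height criterion if for every extension $L$ of $L_0$: $L$ is locally tabular iff $h(L^{\restriction\mathrm C})<\omega$ for every $\mathrm C\subseteq\mathrm{Al}$. The canonical frame of $L$: points are maximal $L$-consistent sets, $uR_\Diamond v$ iff $\Diamond\varphi\in u$ for all $\varphi\in v$; $L$ is canonical if it is valid in its canonical frame. $L_1\oplus L_2$ is the smallest normal logic over $\mathrm A\cup\mathrm B$ containing $L_1\cup L_2$ and all formulas $\Diamond_h\Diamond_v p\to\Diamond_v p$, $\Diamond_v\Diamond_h p\to\Diamond_v p$, $\Diamond_v p\to\Box_h\Diamond_v p$ for $\Diamond_v\in\mathrm A$, $\Diamond_h\in\mathrm B$. *)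

(* Defs.v *)
From HB Require Import structures.
From mathcomp Require Import all_boot all_order.
From mathcomp Require Import boolp classical_sets functions cardinality.

Set Implicit Arguments.
Unset Strict Implicit.
Unset Printing Implicit Defensive.

Local Open Scope classical_set_scope.

(** An ambient finite type [M] supplies the modalities; an alphabet is a subset
    [A : {set M}], and a formula over [A] is a formula all of whose modalities
    lie in [A].  A logic over [A] is a set of formulas over [A]. *)
Inductive form (M : Type) : Type :=
| Var of nat
| Bot
| Imp of form M & form M
| Dia of M & form M.

Arguments Var {M} _.
Arguments Bot {M}.

Section Formulas.
Variable M : finType.
Implicit Types (A C : {set M}) (phi psi : form M).

Definition Neg phi : form M := Imp phi Bot.
Definition Top : form M := Neg Bot.
Definition Or phi psi : form M := Imp (Neg phi) psi.
Definition And phi psi : form M := Neg (Imp phi (Neg psi)).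
Definition Iff phi psi : form M := And (Imp phi psi) (Imp psi phi).
Definition Box (a : M) phi : form M := Neg (Dia a (Neg phi)).

Fixpoint over A phi : bool :=
  match phi with
  | Var _ | Bot => true
  | Imp f g => over A f && over A g
  | Dia a f => (a \in A) && over A f
  end.

Fixpoint vars_below (k : nat) phi : bool :=
  match phi with
  | Var n => (n < k)%N
  | Bot => true
  | Imp f g => vars_below k f && vars_below k g
  | Dia _ f => vars_below k f
  end.

Definition Fm A : set (form M) := [set phi | over A phi].

Fixpoint subst (s : nat -> form M) phi : form M :=
  match phi with
  | Var n => s n
  | Bot => Bot
  | Imp f g => Imp (subst s f) (subst s g)
  | Dia a f => Dia a (subst s f)
  end.

(** Variables and formulas [Dia a f] both count as propositional atoms, so that
    substitution instances of tautologies are tautologies. *)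
Fixpoint bool_eval (v : form M -> bool) phi : bool :=
  match phi with
  | Bot => false
  | Imp f g => bool_eval v f ==> bool_eval v g
  | Var _ | Dia _ _ => v phi
  end.

Definition tautology phi : Prop := forall v, bool_eval v phi.

Record normal_logic A (L : set (form M)) : Prop := NormalLogic {
  normal_over : L `<=` Fm A;
  normal_taut : forall phi, Fm A phi -> tautology phi -> L phi;
  normal_bot : forall a, a \in A -> L (Neg (Dia a Bot));
  normal_or : forall a, a \in A ->
    L (Imp (Dia a (Or (Var 0) (Var 1))) (Or (Dia a (Var 0)) (Dia a (Var 1))));
  normal_mp : forall phi psi, L phi -> L (Imp phi psi) -> L psi;
  normal_subst : forall s phi, (forall n, Fm A (s n)) -> L phi ->
    L (subst s phi);
  normal_mono : forall a phi psi, a \in A -> L (Imp phi psi) ->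
    L (Imp (Dia a phi) (Dia a psi))
}.

Definition extension A (L0 L : set (form M)) : Prop :=
  normal_logic A L /\ L0 `<=` L.

Definition restriction C (L : set (form M)) : set (form M) := L `&` Fm C.

Definition equiv_class A (k : nat) (L : set (form M)) phi : set (form M) :=
  [set psi | Fm A psi /\ vars_below k psi /\ L (Iff phi psi)].

Definition k_finite A (k : nat) (L : set (form M)) : Prop :=
  finite_set [set equiv_class A k L phi | phi in
                [set phi | Fm A phi /\ vars_below k phi]].

Definition locally_tabular A (L : set (form M)) : Prop :=
  forall k, k_finite A k L.

Definition DiaC C phi : form M := \big[Or/Bot]_(a in C) Dia a phi.

Definition DiaC_le C (m : nat) phi : form M :=
  \big[Or/Bot]_(i < m.+1) iter i (DiaC C) phi.

Definition m_transitive C (m : nat) (L : set (form M)) : Prop :=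
  L (Imp (iter m.+1 (DiaC C) (Var 0)) (DiaC_le C m (Var 0))).

(** Values in [omega + 1]: [Some n] is the natural number [n], [None] is
    [omega]. *)
Definition least (P : nat -> Prop) : option nat :=
  match pselect (exists n, `[< P n >]) with
  | left exP => Some (ex_minn exP)
  | right _ => None
  end.

Definition tra C (L : set (form M)) : option nat :=
  least (fun m => m_transitive C m L).

(** [B_h] with the operator [dia] in place of the diamond, and its dual in
    place of the box. *)
Fixpoint height_formula (dia : form M -> form M) (h : nat) : form M :=
  match h with
  | 0 => Bot
  | h'.+1 => Imp (Var h)
      (Neg (dia (Neg (Or (dia (Var h)) (height_formula dia h')))))
  end.

Definition height C (L : set (form M)) : option nat :=
  match tra C L with
  | Some m => least (fun h => L (height_formula (DiaC_le C m) h))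
  | None => None
  end.

Definition finite_height_criterion A (L0 : set (form M)) : Prop :=
  forall L, extension A L0 L ->
    (locally_tabular A L <->
     forall C, C \subset A -> height C (restriction C L) <> None).

(** Frames carry a relation for every [a : M]; the truth of a formula over [A]
    only depends on the relations indexed by [A]. *)
Record frame := Frame {
  point :> Type;
  acc : M -> point -> point -> Prop
}.

Fixpoint sat (F : frame) (V : nat -> set F) (w : F) phi : Prop :=
  match phi with
  | Var n => V n w
  | Bot => False
  | Imp f g => sat V w f -> sat V w g
  | Dia a f => exists2 u : F, acc a w u & sat V u f
  end.

Definition valid (F : frame) phi : Prop :=
  forall (V : nat -> set F) (w : F), sat V w phi.

Definition consistent (L Gamma : set (form M)) : Prop :=
  forall (n : nat) (f : 'I_n -> form M), (forall i, Gamma (f i)) ->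
    ~ L (Neg (\big[And/Top]_(i < n) f i)).

Definition maximal_consistent A (L Gamma : set (form M)) : Prop :=
  [/\ Gamma `<=` Fm A, consistent L Gamma &
      forall Delta, Delta `<=` Fm A -> consistent L Delta ->
        Gamma `<=` Delta -> Delta = Gamma].

Definition canonical_frame A (L : set (form M)) : frame :=
  @Frame {Gamma : set (form M) | maximal_consistent A L Gamma}
    (fun a u v => forall phi, sval v phi -> sval u (Dia a phi)).

Definition canonical_logic A (L : set (form M)) : Prop :=
  forall phi, L phi -> valid (canonical_frame A L) phi.

Definition sum_axioms (A B : {set M}) : set (form M) :=
  [set phi | exists v h : M, [/\ v \in A, h \in B &
    [\/ phi = Imp (Dia h (Dia v (Var 0))) (Dia v (Var 0)),
        phi = Imp (Dia v (Dia h (Var 0))) (Dia v (Var 0)) |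
        phi = Imp (Dia v (Var 0)) (Box h (Dia v (Var 0)))]]].

Definition logic_sum (A B : {set M}) (L1 L2 : set (form M)) : set (form M) :=
  smallest (normal_logic (A :|: B)%SET) (L1 `|` L2 `|` sum_axioms A B).

End Formulas.

(* Main.v *)
(** In an extension [L] of the sum, the truth value of a formula [Dia v phi] with
    [v] in [A] is constant along the relations of [B], so such formulas can be
    pulled out of the modalities of [B].  Hence every formula in [k] variables is
    equivalent to an [A]-formula with [B]-formulas in [k] variables substituted
    for its variables; local tabularity of the two fragments leaves finitely many
    choices for both, and that of each fragment comes from its own criterion.

    Conversely, in a locally tabular logic the master modality is a finite
    disjunction [D], and the one-variable formulas [alt D p n] ("p alternates with
    its negation along a [D]-chain of length [n]") are decreasing in [n], hence
    stabilise.  Substituting for [p] the parity of the level of a point in a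
    refutation of [B_n] bounds the alternations by [n] and makes the refuting
    chain alternate [n] times, so stabilisation at [n] yields [B_n]. *)

From mathcomp Require Import all_boot all_order.
From mathcomp Require Import boolp classical_sets functions cardinality.
Require Import Defs.

Set Implicit Arguments.
Unset Strict Implicit.
Unset Printing Implicit Defensive.

(** * Syntax: alphabets, variable bounds, truth values and substitution for disjunctions and
    iterated diamonds *)

Section Formulas.
Variable M : finType.
Implicit Types (A B C : {set M}) (phi psi chi : form M) (s t : nat -> form M)
  (L : set (form M)).

Lemma over_Neg A phi : over A (Neg phi) = over A phi.
Proof. by rewrite /= andbT. Qed.

Lemma over_Or A phi psi : over A (Or phi psi) = over A phi && over A psi.
Proof. by rewrite /= andbT. Qed.

Lemma over_And A phi psi : over A (And phi psi) = over A phi && over A psi.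
Proof. by rewrite /= !andbT. Qed.

Lemma over_Iff A phi psi : over A (Iff phi psi) = over A phi && over A psi.
Proof. by rewrite /= !andbT andbC [over A psi && _]andbC andbb. Qed.

Lemma over_Imp A phi psi : over A (Imp phi psi) = over A phi && over A psi.
Proof. by []. Qed.

Definition overE := (over_And, over_Iff, over_Or, over_Neg, over_Imp).

Lemma eval_Imp v phi psi :
  bool_eval v (Imp phi psi) = (bool_eval v phi ==> bool_eval v psi).
Proof. by []. Qed.

Lemma eval_Neg v phi : bool_eval v (Neg phi) = ~~ bool_eval v phi.
Proof. by rewrite /= implybF. Qed.

Lemma eval_Or v phi psi :
  bool_eval v (Or phi psi) = bool_eval v phi || bool_eval v psi.
Proof. by rewrite /= implybF implyNb. Qed.

Lemma eval_And v phi psi :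
  bool_eval v (And phi psi) = bool_eval v phi && bool_eval v psi.
Proof. by rewrite /= !implybF negb_imply negbK. Qed.

Lemma eval_Iff v phi psi :
  bool_eval v (Iff phi psi) = (bool_eval v phi == bool_eval v psi).
Proof. by rewrite eval_And /=; case: bool_eval; case: bool_eval. Qed.

Lemma eval_Bot v : bool_eval v (@Bot M) = false.
Proof. by []. Qed.

Lemma eval_Top v : bool_eval v (Top M) = true.
Proof. by []. Qed.

Definition evalE :=
  (eval_Top, eval_And, eval_Iff, eval_Or, eval_Neg, eval_Imp, eval_Bot).

Lemma over_subset A C phi : C \subset A -> over C phi -> over A phi.
Proof.
move=> sCA; elim: phi => //= [f IHf g IHg /andP[/IHf-> /IHg->] //|a f IHf].
by move=> /andP[/(fintype.subsetP sCA)-> /IHf->].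
Qed.

Lemma over_subst A s phi :
  over A phi -> (forall n, over A (s n)) -> over A (subst s phi).
Proof.
move=> + os; elim: phi => //= [f IHf g IHg /andP[/IHf-> /IHg->] //|a f IHf].
by move=> /andP[-> /IHf->].
Qed.

Lemma vars_below_subst k s phi :
  (forall n, vars_below k (s n)) -> vars_below k (subst s phi).
Proof. by move=> vs; elim: phi => //= f -> g ->. Qed.

Lemma subst_bigOr (I : Type) (r : seq I) (P : pred I) (F : I -> form M) s :
  subst s (\big[@Or M/Bot]_(i <- r | P i) F i) =
  \big[@Or M/Bot]_(i <- r | P i) subst s (F i).
Proof. exact: (big_morph (subst s)). Qed.

Lemma over_bigOr A (I : Type) (r : seq I) (P : pred I) (F : I -> form M) :
  (forall i, P i -> over A (F i)) ->
  over A (\big[@Or M/Bot]_(i <- r | P i) F i).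
Proof.
by move=> oF; elim/big_rec: _ => // i phi Pi ophi; rewrite overE oF.
Qed.

Lemma eval_bigOr v (I : Type) (r : seq I) (P : pred I) (F : I -> form M) :
  bool_eval v (\big[@Or M/Bot]_(i <- r | P i) F i) =
  has (fun i => P i && bool_eval v (F i)) r.
Proof.
elim: r => [|i r IHr]; first by rewrite big_nil.
by rewrite big_cons /=; case: (P i); rewrite ?eval_Or IHr.
Qed.

Lemma subst_DiaC C s phi : subst s (DiaC C phi) = DiaC C (subst s phi).
Proof. by rewrite /DiaC subst_bigOr. Qed.

Lemma subst_iter_DiaC C i s phi :
  subst s (iter i (DiaC C) phi) = iter i (DiaC C) (subst s phi).
Proof. by elim: i => //= i <-; rewrite subst_DiaC. Qed.

Lemma subst_DiaC_le C m s phi : subst s (DiaC_le C m phi) = DiaC_le C m (subst s phi).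
Proof.
by rewrite /DiaC_le subst_bigOr; apply: eq_bigr => i _; rewrite subst_iter_DiaC.
Qed.

Lemma over_DiaC C phi : over C phi -> over C (DiaC C phi).
Proof. by move=> ophi; apply: over_bigOr => a aC /=; rewrite aC. Qed.

Lemma over_iter_DiaC C i phi : over C phi -> over C (iter i (DiaC C) phi).
Proof. by move=> ophi; elim: i => //= i; apply: over_DiaC. Qed.

Lemma over_DiaC_le C m phi : over C phi -> over C (DiaC_le C m phi).
Proof. by move=> ophi; apply: over_bigOr => i _; apply: over_iter_DiaC. Qed.

Lemma vars_below_bigOr k (I : Type) (r : seq I) (P : pred I) (F : I -> form M) :
  (forall i, vars_below k (F i)) ->
  vars_below k (\big[@Or M/Bot]_(i <- r | P i) F i).
Proof. by move=> vF; elim/big_rec: _ => // i phi Pi /= ->; rewrite vF. Qed.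

Lemma vars_below_iter_DiaC C k i phi :
  vars_below k phi -> vars_below k (iter i (DiaC C) phi).
Proof. by move=> vphi; elim: i => //= i IH; apply: vars_below_bigOr. Qed.

Lemma vars_below_DiaC_le C k m phi :
  vars_below k phi -> vars_below k (DiaC_le C m phi).
Proof.
by move=> vphi; apply: vars_below_bigOr => i; apply: vars_below_iter_DiaC.
Qed.

End Formulas.

Ltac over_tac := rewrite ?overE; repeat (apply/andP; split); assumption || by [].
(** A truth table: once the connectives are evaluated, it branches on the value of every remaining
    subformula, modal formulas being atoms. *)
Ltac prop_tac := rewrite ?evalE; repeat case: (bool_eval _ _) => //.

(** * Derivations in a normal logic, its fragments, and the master modality *)

Section NormalLogic.
Variables (M : finType) (A : {set M}) (L : set (form M)).
Hypothesis NL : normal_logic A L.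
Implicit Types (phi psi chi : form M).

Lemma logic_over phi : L phi -> over A phi.
Proof. exact: (normal_over NL). Qed.

Lemma logic_taut phi : over A phi -> (forall v, bool_eval v phi) -> L phi.
Proof. exact: (normal_taut NL). Qed.

(** Modus ponens with a tautology. This and its variants with two and three premises replace
    propositional derivations by a check of truth values. *)
Lemma conseq1 phi chi : over A chi -> L phi ->
  (forall v, bool_eval v phi -> bool_eval v chi) -> L chi.
Proof.
move=> ochi Lphi taut; apply: (normal_mp NL Lphi).
apply: (normal_taut NL); first by rewrite /Fm /= ochi (logic_over Lphi).
by move=> v /=; apply/implyP/taut.
Qed.

Lemma conseq2 phi psi chi : over A chi -> L phi -> L psi ->
  (forall v, bool_eval v phi -> bool_eval v psi -> bool_eval v chi) -> L chi.
Proof.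
move=> ochi Lphi Lpsi taut; apply: (normal_mp NL Lpsi).
apply: (conseq1 _ Lphi); first by rewrite /= ochi (logic_over Lpsi).
by move=> v vphi /=; apply/implyP/taut.
Qed.

Lemma conseq3 phi psi rho chi : over A chi -> L phi -> L psi -> L rho ->
  (forall v, bool_eval v phi -> bool_eval v psi -> bool_eval v rho ->
    bool_eval v chi) -> L chi.
Proof.
move=> ochi Lphi Lpsi Lrho taut; apply: (normal_mp NL Lrho).
apply: (conseq2 _ Lphi Lpsi); first by rewrite /= ochi (logic_over Lrho).
by move=> v vphi vpsi /=; apply/implyP/taut.
Qed.

Lemma imp_trans phi psi chi : L (Imp phi psi) -> L (Imp psi chi) -> L (Imp phi chi).
Proof.
move=> Lfg Lgh; move: (logic_over Lfg) (logic_over Lgh).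
rewrite !overE => /andP[? ?] /andP[? ?].
by apply: (conseq2 _ Lfg Lgh); [over_tac | move=> v; prop_tac].
Qed.

Lemma Dia_or a phi psi : a \in A -> over A phi -> over A psi ->
  L (Imp (Dia a (Or phi psi)) (Or (Dia a phi) (Dia a psi))).
Proof.
move=> aA ophi opsi.
have := normal_subst NL (s := fun n => if n is 0 then phi else psi) _ (normal_or NL aA).
by apply=> -[].
Qed.

Lemma Dia_congr a phi psi : a \in A -> L (Iff phi psi) ->
  L (Iff (Dia a phi) (Dia a psi)).
Proof.
move=> aA Le; move: (logic_over Le); rewrite overE => /andP[ophi opsi].
have Lf : L (Imp phi psi) by apply: (conseq1 _ Le); [over_tac | move=> v; prop_tac].
have Lg : L (Imp psi phi) by apply: (conseq1 _ Le); [over_tac | move=> v; prop_tac].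
apply: (conseq2 _ (normal_mono NL aA Lf) (normal_mono NL aA Lg)).
  by rewrite overE /= aA ophi.
by move=> v; prop_tac.
Qed.

Lemma restriction_normal (C : {set M}) : C \subset A -> normal_logic C (restriction C L).
Proof.
move=> sCA; have sub phi : over C phi -> over A phi := over_subset sCA.
split.
- by move=> phi [].
- by move=> phi ophi taut; split=> //; apply: (normal_taut NL) => //; apply: sub.
- move=> a aC; split; last by rewrite /Fm /= aC.
  by apply: (normal_bot NL); apply: (fintype.subsetP sCA).
- move=> a aC; split; last by rewrite /Fm /= aC.
  by apply: (normal_or NL); apply: (fintype.subsetP sCA).
- move=> phi psi [Lphi _] [Li oi]; split; first exact: (normal_mp NL Lphi).
  by move: oi; rewrite /Fm /= => /andP[].
- move=> s phi os [Lphi ophi]; split; last exact: over_subst.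
  by apply: (normal_subst NL) => // n; apply/sub/os.
- move=> a phi psi aC [Li oi]; split; last by rewrite /Fm /= aC.
  by apply: (normal_mono NL) => //; apply: (fintype.subsetP sCA).
Qed.

Lemma DiaC_mono phi psi : L (Imp phi psi) -> L (Imp (DiaC A phi) (DiaC A psi)).
Proof.
move=> Li; rewrite /DiaC; elim/big_ind2: _ => [|f1 f2 g1 g2 L1 L2|a aA].
- exact: (normal_taut NL).
- move: (logic_over L1) (logic_over L2); rewrite !overE => /andP[? ?] /andP[? ?].
  by apply: (conseq2 _ L1 L2); [over_tac | move=> v; prop_tac].
- exact: (normal_mono NL).
Qed.

Lemma iter_DiaC_mono i phi psi : L (Imp phi psi) ->
  L (Imp (iter i (DiaC A) phi) (iter i (DiaC A) psi)).
Proof. by move=> Li; elim: i => //= i; apply: DiaC_mono. Qed.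

Lemma DiaC_le_mono m phi psi : L (Imp phi psi) ->
  L (Imp (DiaC_le A m phi) (DiaC_le A m psi)).
Proof.
move=> Li; rewrite /DiaC_le; elim/big_ind2: _ => [|f1 f2 g1 g2 L1 L2|i _].
- exact: (normal_taut NL).
- move: (logic_over L1) (logic_over L2); rewrite !overE => /andP[? ?] /andP[? ?].
  by apply: (conseq2 _ L1 L2); [over_tac | move=> v; prop_tac].
- exact: iter_DiaC_mono.
Qed.

Lemma bigOr_lub (I : Type) (r : seq I) (P : pred I) (F : I -> form M) chi :
  over A chi -> (forall i, P i -> L (Imp (F i) chi)) ->
  L (Imp (\big[@Or M/Bot]_(i <- r | P i) F i) chi).
Proof.
move=> ochi FP; elim/big_rec: _ => [|i phi Pi Lphi].
  by apply: (normal_taut NL); rewrite /Fm /= ?ochi.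
have Fi := FP i Pi; move: (logic_over Lphi) (logic_over Fi).
rewrite !overE => /andP[? ?] /andP[? ?].
by apply: (conseq2 _ Fi Lphi); [over_tac | move=> v; prop_tac].
Qed.

Lemma iter_DiaC_le m i phi : over A phi -> (i <= m)%N ->
  L (Imp (iter i (DiaC A) phi) (DiaC_le A m phi)).
Proof.
move=> ophi im; apply: (normal_taut NL).
  by rewrite /Fm /= over_iter_DiaC ?over_DiaC_le.
move=> v; rewrite eval_Imp; apply/implyP => vi; rewrite eval_bigOr.
by apply/hasP; exists (Ordinal (im : i < m.+1)%N); rewrite ?mem_index_enum.
Qed.

Lemma DiaC_bot : L (Imp (DiaC A Bot) Bot).
Proof. by apply: bigOr_lub => // a aA; apply: (normal_bot NL). Qed.

Lemma DiaC_or phi psi : over A phi -> over A psi ->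
  L (Imp (DiaC A (Or phi psi)) (Or (DiaC A phi) (DiaC A psi))).
Proof.
move=> ophi opsi; apply: bigOr_lub => [|a aA].
  by rewrite overE !over_DiaC.
have oor : over A (Dia a (Or phi psi)) by rewrite /= aA ophi opsi.
apply: (conseq1 _ (Dia_or aA ophi opsi)); first by rewrite !overE !over_DiaC // oor.
move=> v; rewrite !evalE => /implyP vor; apply/implyP => /vor.
rewrite !eval_bigOr => /orP[va|va]; apply/orP; [left|right];
  by apply/hasP; exists a; rewrite ?mem_index_enum ?aA.
Qed.

Lemma DiaC_bigOr_lub (I : Type) (r : seq I) (P : pred I) (F : I -> form M) chi :
  over A chi -> (forall i, P i -> over A (F i)) ->
  (forall i, P i -> L (Imp (DiaC A (F i)) chi)) ->
  L (Imp (DiaC A (\big[@Or M/Bot]_(i <- r | P i) F i)) chi).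
Proof.
move=> ochi oF FP.
(* The induction also carries membership in the alphabet, which [DiaC_or] requires of the tail of
   the disjunction. *)
suff [_] : over A (\big[@Or M/Bot]_(i <- r | P i) F i) /\
  L (Imp (DiaC A (\big[@Or M/Bot]_(i <- r | P i) F i)) chi) by [].
elim/big_rec: _ => [|i phi Pi [ophi Lphi]].
  split=> //; apply: (imp_trans DiaC_bot).
  by apply: (normal_taut NL); rewrite /Fm /= ?ochi.
have oFi := oF i Pi; split; first by rewrite overE oFi.
have [oDi oD] := (over_DiaC oFi, over_DiaC ophi).
apply: (conseq3 _ (DiaC_or oFi ophi) (FP i Pi) Lphi).
  by rewrite overE over_DiaC ?overE ?oFi.
by move=> v; prop_tac.
Qed.

Section Pretransitive.
Variable m : nat.
Hypothesis mtr : m_transitive A m L.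

(** One more diamond shifts each disjunct of exponent below [m] to the next one; the disjunct of
    exponent [m] is brought back by [m]-transitivity. *)
Lemma DiaC_DiaC_le phi : over A phi ->
  L (Imp (DiaC A (DiaC_le A m phi)) (DiaC_le A m phi)).
Proof.
move=> ophi; apply: DiaC_bigOr_lub => [|i _|i _].
- exact: over_DiaC_le.
- exact: over_iter_DiaC.
- rewrite -iterS; have [im|] := ltnP i m; first exact: iter_DiaC_le.
  move=> mi; have -> : i = m :> nat by apply/eqP; rewrite eqn_leq mi -ltnS ltn_ord.
  have := normal_subst NL (s := fun=> phi) _ mtr.
  rewrite [subst _ _]/= -/(iter m.+1 _ _) subst_DiaC_le subst_DiaC.
  by rewrite subst_iter_DiaC; apply.
Qed.

Lemma DiaC_le_trans phi : over A phi ->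
  L (Imp (DiaC_le A m (DiaC_le A m phi)) (DiaC_le A m phi)).
Proof.
move=> ophi; have oD := over_DiaC_le m ophi; apply: bigOr_lub => // i _.
elim: {i}(val i) => [|i IHi] /=; last exact: imp_trans (DiaC_mono IHi) (DiaC_DiaC_le _).
by apply: (normal_taut NL); rewrite /Fm /= ?oD // => v /=; apply: implybb.
Qed.

End Pretransitive.

Lemma DiaC_le_bot m : L (Imp (DiaC_le A m Bot) Bot).
Proof.
apply: bigOr_lub => // i _; elim: {i}(val i) => [|i IHi].
  exact: (normal_taut NL).
exact: imp_trans (DiaC_mono IHi) DiaC_bot.
Qed.

End NormalLogic.

(** * Alternation along chains of an S4-like operator [D], and the height formulas *)

Section Alternation.
Variables (M : finType) (A : {set M}) (L : set (form M)).
Hypothesis NL : normal_logic A L.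
Variable D : form M -> form M.
Hypothesis D_over : forall phi, over A phi -> over A (D phi).
Hypothesis D_mono : forall phi psi, L (Imp phi psi) -> L (Imp (D phi) (D psi)).
Hypothesis D_refl : forall phi, over A phi -> L (Imp phi (D phi)).
Hypothesis D_trans : forall phi, over A phi -> L (Imp (D (D phi)) (D phi)).
Hypothesis D_bot : L (Imp (D Bot) Bot).
Implicit Types (q phi psi : form M) (i n : nat).

Definition alt_lit q i : form M := if odd i then q else Neg q.

(** Indices count down along the chain: the first point reached satisfies the literal of index [i],
    the last one the literal of index 1, which is [q]. *)
Fixpoint alt q i : form M :=
  if i is j.+1 then D (And (alt_lit q i) (alt q j)) else Top M.

Lemma over_alt_lit q i : over A q -> over A (alt_lit q i).
Proof. by rewrite /alt_lit; case: odd; rewrite ?overE. Qed.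

Lemma over_alt q i : over A q -> over A (alt q i).
Proof.
by move=> oq; elim: i => // i oi; apply: D_over; rewrite overE oi over_alt_lit.
Qed.

Lemma alt_decr q i j : over A q -> (i <= j)%N -> L (Imp (alt q j) (alt q i)).
Proof.
move=> oq; have oa k := over_alt k oq; have ol k := over_alt_lit k oq.
have step k : L (Imp (alt q k.+1) (alt q k)).
  case: k => [|k].
    by apply: (logic_taut NL) => [|v]; [rewrite overE oa | rewrite !evalE implybT].
  (* Dropping the outer literal leaves [D] in front of [alt q k.+1], which itself starts with [D];
     transitivity merges the two. *)
  apply: (imp_trans NL _ (D_trans _)); last by rewrite overE oa ol.
  apply: D_mono; apply: (logic_taut NL) => [|v].
    by rewrite overE overE ol !(oa k.+1).
  by rewrite !evalE; apply/implyP => /andP[].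
elim: j => [|j IHj]; first by rewrite leqn0 => /eqP->; apply: (logic_taut NL).
rewrite leq_eqVlt ltnS => /predU1P[->|/IHj]; last exact: (imp_trans NL (step _)).
apply: (logic_taut NL) => [|v]; first by rewrite overE !oa.
by rewrite evalE implybb.
Qed.

(** "The level is at least [i]", for levels [0, ..., n]. *)
Fixpoint level n i : form M :=
  if i is j.+1 then
    if (j < n)%N then And (level n j) (D (Var i)) else Bot
  else Top M.

(** The exclusive disjunction of [level n 1], ..., [level n k]. Levels are nested, so its value is
    the parity of the number of levels reached, counted up to [k]. *)
Fixpoint level_parity n k : form M :=
  if k is j.+1 then Neg (Iff (level_parity n j) (level n k)) else Bot.

Lemma level_parityS n k :
  level_parity n k.+1 = Neg (Iff (level_parity n k) (level n k.+1)).
Proof. by []. Qed.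

Lemma over_level n i : over A (level n i).
Proof. by elim: i => //= i oi; case: ifP => // _; rewrite overE oi D_over. Qed.

Lemma over_level_parity n k : over A (level_parity n k).
Proof. by elim: k => // k ok; rewrite level_parityS !overE ok over_level. Qed.

Lemma eval_level_anti v n i j : (i <= j)%N ->
  bool_eval v (level n j) -> bool_eval v (level n i).
Proof.
elim: j => [|j IHj]; first by rewrite leqn0 => /eqP->.
rewrite leq_eqVlt ltnS => /predU1P[->//|/IHj IHij] vj; apply: IHij.
by move: vj; rewrite [level _ _]/=; case: ifP => // _; rewrite evalE => /andP[].
Qed.

Lemma eval_level_parity v n i k :
  bool_eval v (level n i) -> ~~ bool_eval v (level n i.+1) ->
  bool_eval v (level_parity n k) = odd (minn i k).
Proof.
move=> vi vi1; elim: k => [|k IHk]; first by rewrite minn0.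
rewrite level_parityS !evalE {}IHk.
have [ki|ik] := ltnP k i.
  rewrite (eval_level_anti ki vi) (minn_idPr ki) /=.
  by case: (odd k).
rewrite (minn_idPl (leqW ik)).
case vk: (bool_eval v (level n k.+1)); last by case: odd.
by rewrite (@eval_level_anti v n i.+1 k.+1) in vi1.
Qed.

Lemma eval_alt_lit v n i : (i <= n)%N ->
  bool_eval v (level n i) -> ~~ bool_eval v (level n i.+1) ->
  bool_eval v (alt_lit (level_parity n n) i).
Proof.
move=> le_in vi vi1; have vq := eval_level_parity n vi vi1.
rewrite (minn_idPl le_in) in vq.
by rewrite /alt_lit; case: ifP => oi; rewrite ?evalE vq oi.
Qed.

(** Up to [n] a level is a conjunction of formulas starting with [D], each absorbing a further [D]
    by transitivity; beyond [n] it is [Bot] and [D_bot] applies. So levels never rise along a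
    [D]-chain. *)
Lemma D_level n i : L (Imp (D (level n i)) (level n i)).
Proof.
elim: i => [|i IHi].
  apply: (normal_taut NL) => [|v]; last by rewrite eval_Imp implybT.
  by rewrite /Fm /= D_over.
rewrite /=; case: ifP => // _.
have [ol oV] := (over_level n i, D_over (isT : over A (Var i.+1))).
have L1 : L (Imp (D (And (level n i) (D (Var i.+1)))) (level n i)).
  apply: (imp_trans NL _ IHi); apply: D_mono; apply: (normal_taut NL) => [|v].
    by rewrite /Fm /= ol oV.
  by prop_tac.
have L2 : L (Imp (D (And (level n i) (D (Var i.+1)))) (D (Var i.+1))).
  apply: (imp_trans NL _ (D_trans _)) => //; apply: D_mono.
  apply: (normal_taut NL) => [|v]; first by rewrite /Fm /= ol oV.
  by prop_tac.
apply: (conseq2 NL _ L1 L2) => [|v]; last by prop_tac.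
by rewrite !overE D_over ?overE ?ol ?oV.
Qed.

(** Each change of parity costs a level. The bound includes [n.+1], where the level is [Bot]: the
    parity formula cannot alternate [n.+1] times. *)
Lemma alt_level n i : (i <= n.+1)%N ->
  L (Imp (alt (level_parity n n) i) (level n i)).
Proof.
have oq := over_level_parity n n.
elim: i => [_|i IHi lt_in]; first exact: (normal_taut NL).
apply: (imp_trans NL _ (D_level n i.+1)); apply: D_mono.
have [oa ol] := (over_alt i oq, over_alt_lit i.+1 oq).
apply: (conseq1 NL _ (IHi (ltnW lt_in))) => [|v].
  by rewrite !overE oa ol over_level.
rewrite !evalE => /implyP va; apply/implyP => /andP[vl /va vi].
(* If level [i.+1] failed, the level would be exactly [i], so the literal of index [i] would hold,
   contradicting the one of index [i.+1]. *)
apply: contraLR vl => vi1; have := eval_alt_lit (ltnSE lt_in) vi vi1.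
by rewrite /alt_lit /=; case: odd; rewrite ?evalE ?negbK.
Qed.

Lemma height_formula_over h : over A (height_formula D h).
Proof.
elim: h => //= h oh; rewrite andbT; apply: D_over; rewrite overE overE oh.
by rewrite D_over.
Qed.

Lemma not_height_formula_D h : L (Imp (Neg (height_formula D h.+1))
  (D (Neg (Or (D (Var h.+1)) (height_formula D h))))).
Proof.
have oh := height_formula_over h; have oV := D_over (isT : over A (Var h.+1)).
apply: (normal_taut NL) => [|v].
  by rewrite /Fm /= !D_over //= oV oh.
by rewrite [height_formula _ _]/= -/(Neg _); prop_tac.
Qed.

(** A refutation of the formula of index [h.+1] satisfies [Var h.+1], hence [D (Var h.+1)], and sees
    a refutation of index [h], whose level passes back by [D_level]. *)
Lemma not_height_formula_level n h : (h <= n)%N ->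
  L (Imp (Neg (height_formula D h)) (level n h)).
Proof.
elim: h => [_|h IHh lt_hn]; first exact: (normal_taut NL).
have oh := height_formula_over h; have oV := D_over (isT : over A (Var h.+1)).
have L1 : L (Imp (D (Neg (Or (D (Var h.+1)) (height_formula D h)))) (level n h)).
  apply: (imp_trans NL _ (D_level n h)); apply: D_mono.
  apply: (conseq1 NL _ (IHh (ltnW lt_hn))) => [|v]; last by prop_tac.
  by rewrite !overE oV oh over_level.
have L2 := imp_trans NL (not_height_formula_D h) L1.
apply: (conseq2 NL _ L2 (D_refl (isT : over A (Var h.+1)))) => [|v].
  by rewrite overE overE height_formula_over over_level.
rewrite [level n h.+1]/= lt_hn [height_formula _ h.+1]/= -/(Neg _).
by prop_tac.
Qed.

Lemma not_height_formula_lit n h : (h < n)%N ->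
  L (Imp (And (Neg (height_formula D h.+1)) (Neg (level n h.+2)))
    (alt_lit (level_parity n n) h.+1)).
Proof.
move=> lt_hn; have ol := over_alt_lit h.+1 (over_level_parity n n).
move: (not_height_formula_level lt_hn) (height_formula_over h.+1).
move: (height_formula D h.+1) => B Llevel oB.
apply: (conseq1 NL _ Llevel) => [|v]; first by rewrite !overE oB ol over_level.
rewrite !evalE => /implyP vl; apply/implyP => /andP[/vl vw vw1].
exact: eval_alt_lit.
Qed.

(** The refuting chain has levels dropping by exactly one at each step, so its parities alternate.
    Excluding level [h.+2] makes the level of the current point exactly [h.+1]. *)
Lemma not_height_formula_alt n h : (h < n)%N ->
  L (Imp (And (Neg (height_formula D h.+1)) (Neg (level n h.+2)))
    (And (alt_lit (level_parity n n) h.+1) (alt (level_parity n n) h))).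
Proof.
have oq := over_level_parity n n; set q := level_parity n n in oq *.
have ol k := over_alt_lit k oq; have oa k := over_alt k oq.
have oh k := height_formula_over k; have ow k := over_level n k.
elim: h => [|h IHh] lt_hn; move: (not_height_formula_lit lt_hn).
  move: (height_formula D 1) (oh 1%N) => B oB Llit.
  by apply: (conseq1 NL _ Llit) => [|v]; [rewrite !overE oB ow ol | rewrite !evalE andbT].
have oV := D_over (isT : over A (Var h.+2)).
(* The next point of the chain fails [D (Var h.+2)], a conjunct of level [h.+2], so the induction
   hypothesis applies there. *)
have L1 : L (Imp (Neg (Or (D (Var h.+2)) (height_formula D h.+1)))
    (And (Neg (height_formula D h.+1)) (Neg (level n h.+2)))).
  rewrite [level n h.+2]/= lt_hn -/(level n h.+1).
  move: (height_formula D h.+1) (oh h.+1) (level n h.+1) (ow h.+1) => B oB w ow'.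
  apply: (logic_taut NL) => [|v]; first by rewrite !overE oB ow' oV.
  by prop_tac.
move: (imp_trans NL (not_height_formula_D h.+1)
  (D_mono (imp_trans NL L1 (IHh (ltnW lt_hn))))).
rewrite -/(alt q h.+1).
move: (height_formula D h.+2) (oh h.+2) => B oB Lalt Llit.
apply: (conseq2 NL _ Lalt Llit) => [|v]; first by rewrite !overE oB ow ol oa.
by prop_tac.
Qed.

(** [alt] at [n.+1] is refutable, hence by stability so is [alt] at [n]; a refutation of the height
    formula would produce the latter. *)
Lemma alt_stable_height n :
  L (Imp (alt (level_parity n n) n) (alt (level_parity n n) n.+1)) ->
  L (height_formula D n).
Proof.
move=> Lalt; have := imp_trans NL Lalt (alt_level (leqnn n.+1)).
rewrite [level _ _]/= ltnn; have := @not_height_formula_alt n.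
have oq := over_level_parity n n; move: (level_parity n n) oq => q oq.
(* For [n = 0], [alt] is [Top], so the logic is inconsistent and contains [Bot], the height formula
   of index 0. *)
case: n Lalt => [|n] _ Lstep Lbot.
  by apply: (conseq1 NL _ Lbot) => // v; rewrite !evalE.
have := imp_trans NL (imp_trans NL (Lstep n (ltnSn n)) (D_refl _)) Lbot.
rewrite [level _ n.+2]/= ltnn overE over_alt_lit // over_alt // => /(_ isT).
move: (height_formula D n.+1) (height_formula_over n.+1) => B oB Lb.
by apply: (conseq1 NL _ Lb) => // v; prop_tac.
Qed.

End Alternation.

(** * Finiteness up to equivalence, expressed by finitely many representatives *)

Section Representatives.
Local Open Scope classical_set_scope.
Variable M : finType.
Implicit Types (A C : {set M}) (L : set (form M)) (phi psi : form M).

Lemma Iff_refl A L phi : normal_logic A L -> over A phi -> L (Iff phi phi).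
Proof.
by move=> NL o; apply: (logic_taut NL) => [|v]; rewrite ?overE ?evalE ?eqxx ?o.
Qed.

Lemma Iff_trans A L phi psi chi : normal_logic A L ->
  L (Iff phi psi) -> L (Iff psi chi) -> L (Iff phi chi).
Proof.
move=> NL L1 L2; move: (logic_over NL L1) (logic_over NL L2).
rewrite !overE => /andP[? ?] /andP[? ?].
by apply: (conseq2 NL _ L1 L2); [over_tac | move=> v; prop_tac].
Qed.

Lemma Iff_sym A L phi psi : normal_logic A L ->
  L (Iff phi psi) -> L (Iff psi phi).
Proof.
move=> NL L1; move: (logic_over NL L1); rewrite !overE => /andP[? ?].
by apply: (conseq1 NL _ L1); [over_tac | move=> v; prop_tac].
Qed.

Lemma eq_equiv_class A k L phi psi : normal_logic A L ->
  L (Iff phi psi) -> equiv_class A k L phi = equiv_class A k L psi.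
Proof.
move=> NL Le; apply/seteqP; split=> chi [oc [vc Lc]]; split=> //; split=> //.
  exact: (Iff_trans NL (Iff_sym NL Le) Lc).
exact: (Iff_trans NL Le Lc).
Qed.

(** The representatives form a total sequence, well-formed at every index, so that it can be used
    directly as a substitution. *)
Lemma k_finiteP A k L : normal_logic A L ->
  k_finite A k L <-> exists n (r : nat -> form M),
    (forall i, over A (r i) /\ vars_below k (r i)) /\
    forall phi, over A phi -> vars_below k phi ->
      exists2 i, (i < n)%N & L (Iff phi (r i)).
Proof.
move=> NL; split=> [/finite_seqP[s sE]|[n [r [rP rE]]]].
  pose good i := [set phi | [/\ over A phi, vars_below k phi &
    equiv_class A k L phi = nth set0 s i]].
  (* [Bot] fills the indices at which no formula has the listed class; it lies over every alphabet
     and contains no variable. *)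
  pose r i := if pselect (exists phi, good i phi) is left ex then sval (cid ex) else Bot.
  exists (size s), r; split=> [i|phi op vp].
    by rewrite /r; case: pselect => // ex; case: cid => phi [].
  have : [set equiv_class A k L phi | phi in [set phi | Fm A phi /\ vars_below k phi]]
    (equiv_class A k L phi) by exists phi.
  rewrite sE /= => /(nthP set0)[i ltis ei]; exists i => //.
  rewrite /r; case: pselect => [ex|]; last by case; exists phi.
  case: cid => psi [opsi vpsi /=]; rewrite ei => epsi.
  have : equiv_class A k L psi psi by split=> //; split=> //; exact: (Iff_refl NL).
  by rewrite epsi => -[_ []].
apply: (@sub_finite_set _ _ ((fun i => equiv_class A k L (r i)) @` `I_n)).
  move=> _ [phi [op vp] <-]; have [i ltin Li] := rE phi op vp.
  by exists i => //; exact/esym/(eq_equiv_class k NL Li).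
exact/finite_image/finite_II.
Qed.

Lemma k_finite_pigeonhole A k L (f : nat -> form M) : normal_logic A L ->
  k_finite A k L -> (forall i, over A (f i) /\ vars_below k (f i)) ->
  exists i j, (i < j)%N /\ L (Iff (f i) (f j)).
Proof.
move=> NL /(k_finiteP _ NL)[n [r [_ rE]]] fP.
have /choice[c cP] i : exists c : 'I_n, L (Iff (f i) (r c)).
  by have [ofi vfi] := fP i; have [c cn Lc] := rE _ ofi vfi; exists (Ordinal cn).
have /injectivePn[i [j neq eqc]] : ~~ injectiveb (fun i : 'I_n.+1 => c i).
  by apply/negP => /injectiveP/leq_card; rewrite !card_ord ltnn.
have Lij : forall i j : nat, c i = c j -> L (Iff (f i) (f j)).
  by move=> i' j' e; apply: (Iff_trans NL (cP i')) => //; rewrite e; exact: (Iff_sym NL).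
have : (i != j :> nat) by [].
by rewrite neq_ltn => /orP[lt|lt]; [exists i, j|exists j, i]; split=> //; exact: Lij.
Qed.

(** The classes of the fragment are the traces on [Fm C] of classes of [L]. *)
Lemma k_finite_restriction A C k L : normal_logic A L -> C \subset A ->
  k_finite A k L -> k_finite C k (restriction C L).
Proof.
move=> NL sCA /(finite_image (fun X => X `&` Fm C)); apply: sub_finite_set.
move=> _ [phi [oC vphi] <-] /=.
exists (equiv_class A k L phi).
  by exists phi => //; split=> //; exact: over_subset oC.
apply/seteqP; split=> psi.
  by move=> [[_ [vpsi Lpsi]] opsi]; do 3?split=> //;
  change (over C (Iff phi psi)); rewrite over_Iff oC.
by move=> [opsi [vpsi [Lpsi _]]]; do 3?split=> //; exact: over_subset opsi.
Qed.

End Representatives.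

(** The pigeonhole principle is applied twice to formulas in one variable: to the bounded diamonds,
    giving pretransitivity, and to the alternation formulas, giving a height formula. *)
Lemma locally_tabular_height (M : finType) (A : {set M}) (L : set (form M)) :
  normal_logic A L -> locally_tabular A L -> height A L <> None.
Proof.
move=> NL lt.
have leastP (P : nat -> Prop) n : P n -> exists2 m, least P = Some m & P m.
  move=> Pn; rewrite /least; case: pselect => [ex|[]]; last by exists n; apply/asboolP.
  by case: ex_minnP => m /asboolP Pm _; exists m.
have [m [n [lt_mn Lmn]]] : exists i j, (i < j)%N /\
    L (Iff (DiaC_le A i (Var 0)) (DiaC_le A j (Var 0))).
  apply: (k_finite_pigeonhole NL (lt 1%N)) => i.
  by rewrite over_DiaC_le // vars_below_DiaC_le.
have mtr : m_transitive A m L.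
  (* As [m < n], the iterate [m.+1] is a disjunct of the bounded diamond at [n], which is equivalent
     to the one at [m]. *)
  have L1 := iter_DiaC_le NL (isT : over A (Var 0)) lt_mn.
  apply: (conseq2 NL _ Lmn L1) => [|v]; last first.
    by rewrite !evalE => /eqP->.
  by rewrite overE over_iter_DiaC ?over_DiaC_le.
rewrite /height /tra; have [m' -> {}mtr] := leastP (fun m => m_transitive A m L) m mtr.
set D := DiaC_le A m'.
have D_over phi : over A phi -> over A (D phi) := @over_DiaC_le _ A m' phi.
have D_mono phi psi : L (Imp phi psi) -> L (Imp (D phi) (D psi)).
  exact: DiaC_le_mono.
have D_refl phi : over A phi -> L (Imp phi (D phi)).
  by move=> ophi; apply: (iter_DiaC_le NL ophi (leq0n m')).
have D_trans phi : over A phi -> L (Imp (D (D phi)) (D phi)).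
  exact: DiaC_le_trans.
have D_bot : L (Imp (D Bot) Bot) := DiaC_le_bot NL m'.
have oalt i : over A (alt D (Var 0) i) := over_alt D_over (q := Var 0) i isT.
have [i [j [lt_ij Lij]]] : exists i j, (i < j)%N /\
    L (Iff (alt D (Var 0) i) (alt D (Var 0) j)).
  apply: (k_finite_pigeonhole NL (lt 1%N)) => i; split=> //.
  elim: i => // i IHi /=; apply: vars_below_DiaC_le.
  by rewrite /= IHi /alt_lit; case: ifP.
(* Equivalence of [i] and [j], with [i < j], and monotone decrease force stability already between
   [i] and [i.+1]. *)
have Lalt : L (Imp (alt D (Var 0) i) (alt D (Var 0) i.+1)).
  have Ld := alt_decr NL D_over D_mono D_trans (isT : over A (Var 0)) lt_ij.
  apply: (conseq2 NL _ Lij Ld) => [|v]; first by rewrite overE !oalt.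
  by rewrite !evalE => /eqP->.
pose q := level_parity D i i.
have oq : over A q by apply: over_level_parity.
have subst_alt k : subst (fun=> q) (alt D (Var 0) k) = alt D q k.
  elim: k => // k IHk; rewrite /= subst_DiaC_le -/D.
  by congr (D (And _ _)); rewrite ?IHk // /alt_lit; case: ifP.
have := normal_subst NL (s := fun=> q) (fun=> oq) Lalt.
rewrite [subst _ _]/= -/(alt D (Var 0) i.+1) !subst_alt => Lq.
have [h -> //] := leastP (fun h => L (height_formula D h)) i
  (alt_stable_height NL D_over D_mono D_refl D_trans D_bot Lq).
Qed.

(** * Extensions of the sum: pulling [A]-diamonds out of [B]-diamonds *)

Section LogicSum.
Local Open Scope classical_set_scope.
Variables (M : finType) (A B : {set M}) (L : set (form M)).
Hypothesis NL : normal_logic (A :|: B)%SET L.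
Hypothesis Lsum : sum_axioms A B `<=` L.
Implicit Types (phi psi chi : form M).

Let sA phi : over A phi -> over (A :|: B)%SET phi.
Proof. exact/over_subset/finset.subsetUl. Qed.

Let sB phi : over B phi -> over (A :|: B)%SET phi.
Proof. exact/over_subset/finset.subsetUr. Qed.

Lemma Dia_Dia_sum v h phi : v \in A -> h \in B -> over (A :|: B)%SET phi ->
  L (Imp (Dia h (Dia v phi)) (Dia v phi)).
Proof.
move=> vA hB ophi.
have /(normal_subst NL (s := fun=> phi) (fun=> ophi)) //: 
  L (Imp (Dia h (Dia v (Var 0))) (Dia v (Var 0))).
by apply: Lsum; exists v, h; split=> //; apply: Or31.
Qed.

Lemma Dia_not_Dia_sum v h phi : v \in A -> h \in B -> over (A :|: B)%SET phi ->
  L (Imp (Dia h (Neg (Dia v phi))) (Neg (Dia v phi))).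
Proof.
move=> vA hB ophi.
have /(normal_subst NL (s := fun=> phi) (fun=> ophi)) Lb :
  L (Imp (Dia v (Var 0)) (Box h (Dia v (Var 0)))).
  by apply: Lsum; exists v, h; split=> //; apply: Or33.
change (L (Imp (Dia v phi) (Neg (Dia h (Neg (Dia v phi)))))) in Lb.
have od : over (A :|: B)%SET (Dia v phi) by rewrite /= finset.in_setU vA ophi.
have oh : over (A :|: B)%SET (Dia h (Neg (Dia v phi))).
  by rewrite /= finset.in_setU hB orbT finset.in_setU vA ophi.
apply: (conseq1 NL _ Lb) => [|e]; first by rewrite !overE oh od.
by prop_tac.
Qed.

(** A case distinction on [Dia v phi] commutes with [Dia h], because neither this formula nor its
    negation changes its truth value on passing to an [h]-successor. *)
Lemma Dia_sum_split v h phi chi1 chi0 chi : v \in A -> h \in B ->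
  over (A :|: B)%SET phi ->
  L (Iff chi (Or (And (Dia v phi) chi1) (And (Neg (Dia v phi)) chi0))) ->
  L (Iff (Dia h chi) (Or (And (Dia v phi) (Dia h chi1))
                         (And (Neg (Dia v phi)) (Dia h chi0)))).
Proof.
move=> vA hB ophi Lchi.
have [Ld Ln] := (Dia_Dia_sum vA hB ophi, Dia_not_Dia_sum vA hB ophi).
have hAB : h \in (A :|: B)%SET by rewrite finset.in_setU hB orbT.
have od : over (A :|: B)%SET (Dia v phi) by rewrite /= finset.in_setU vA ophi.
have oD psi : over (A :|: B)%SET (Dia h psi) = over (A :|: B)%SET psi by rewrite /= hAB.
move: (logic_over NL Lchi); move: (Dia v phi) od Ld Ln Lchi => d od Ld Ln Lchi.
rewrite !overE => /and3P[ochi /andP[_ o1] /andP[_ o0]].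
have mono f g : L (Imp f g) -> L (Imp (Dia h f) (Dia h g)).
  exact: (normal_mono NL hAB).
have Dor f g : over (A :|: B)%SET f -> over (A :|: B)%SET g ->
  L (Imp (Dia h (Or f g)) (Or (Dia h f) (Dia h g))).
  exact: (Dia_or NL hAB).
have from1 : L (Imp (Dia h (And d chi1)) (And d (Dia h chi1))).
  have M1 : L (Imp (Dia h (And d chi1)) (Dia h d)).
    by apply/mono/(logic_taut NL) => [|e]; [rewrite !overE od o1 | prop_tac].
  have M2 : L (Imp (Dia h (And d chi1)) (Dia h chi1)).
    by apply/mono/(logic_taut NL) => [|e]; [rewrite !overE od o1 | prop_tac].
  apply: (conseq2 NL _ (imp_trans NL M1 Ld) M2) => [|e]; last by prop_tac.
  by rewrite !overE !oD !overE od o1.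
have from0 : L (Imp (Dia h (And (Neg d) chi0)) (And (Neg d) (Dia h chi0))).
  have M1 : L (Imp (Dia h (And (Neg d) chi0)) (Dia h (Neg d))).
    by apply/mono/(logic_taut NL) => [|e]; [rewrite !overE od o0 | prop_tac].
  have M2 : L (Imp (Dia h (And (Neg d) chi0)) (Dia h chi0)).
    by apply/mono/(logic_taut NL) => [|e]; [rewrite !overE od o0 | prop_tac].
  apply: (conseq2 NL _ (imp_trans NL M1 Ln) M2) => [|e]; last by prop_tac.
  by rewrite !overE !oD !overE od o0.
(* Where [chi] fails although [chi1] holds, [Dia v phi] must fail; the second disjunct is later
   excluded by [Ln]. *)
have to1 : L (Imp (Dia h chi1) (Or (Dia h chi) (Dia h (Neg d)))).
  apply: (imp_trans NL _ (Dor _ _ _ _)); rewrite ?overE //; apply: mono.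
  by apply: (conseq1 NL _ Lchi) => [|e]; [rewrite !overE ochi od o1 | prop_tac].
have to0 : L (Imp (Dia h chi0) (Or (Dia h chi) (Dia h d))).
  apply: (imp_trans NL _ (Dor _ _ _ _)); rewrite ?overE //; apply: mono.
  by apply: (conseq1 NL _ Lchi) => [|e]; [rewrite !overE ochi od o0 | prop_tac].
have ltr : L (Imp (Dia h chi) (Or (And d (Dia h chi1)) (And (Neg d) (Dia h chi0)))).
  apply: (imp_trans NL (mono _ _ _)); first last.
  - apply: (imp_trans NL (Dor (And d chi1) (And (Neg d) chi0) _ _)).
    + by rewrite overE od.
    + by rewrite overE overE od.
    apply: (conseq2 NL _ from1 from0) => [|e]; last by prop_tac.
    by rewrite !overE !oD !overE od o1 o0.
  - by apply: (conseq1 NL _ Lchi) => [|e]; [rewrite !overE ochi od o1 o0 | prop_tac].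
have rtl1 : L (Imp (And d (Dia h chi1)) (Dia h chi)).
  apply: (conseq2 NL _ to1 Ln) => [|e]; last by prop_tac.
  by rewrite !overE !oD od o1.
have rtl0 : L (Imp (And (Neg d) (Dia h chi0)) (Dia h chi)).
  apply: (conseq2 NL _ to0 Ld) => [|e]; last by prop_tac.
  by rewrite !overE !oD od o0.
apply: (conseq3 NL _ ltr rtl1 rtl0) => [|e]; last by prop_tac.
by rewrite !overE !oD ochi od o1 o0.
Qed.

Section NormalForm.
Variables (k n : nat) (r : nat -> form M).
Hypothesis rP : forall i, over B (r i) /\ vars_below k (r i).
Hypothesis rE : forall phi, over B phi -> vars_below k phi ->
  exists2 i, (i < n)%N & restriction B L (Iff phi (r i)).

(** The normal form: variable [i] of the [A]-formula [alpha] stands for the [i]-th representative of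
    the [B]-formulas in [k] variables. *)
Definition representable phi : Prop :=
  exists alpha, [/\ over A alpha, vars_below n alpha & L (Iff phi (subst r alpha))].

Lemma representable_base phi : over B phi -> vars_below k phi -> representable phi.
Proof. by move=> ophi /(rE ophi)[i ltin [Li _]]; exists (Var i). Qed.

Lemma representable_congr phi psi :
  L (Iff phi psi) -> representable psi -> representable phi.
Proof.
move=> Le [alpha [oa va La]]; exists alpha; split=> //; exact: (Iff_trans NL Le).
Qed.

Lemma representable_Imp phi psi :
  representable phi -> representable psi -> representable (Imp phi psi).
Proof.
move=> [f [of_ vf Lf]] [g [og vg Lg]]; exists (Imp f g).
rewrite /= of_ vf og vg; split=> //.
move: (logic_over NL Lf) (logic_over NL Lg); rewrite !overE => /andP[? ?] /andP[? ?].
by apply: (conseq2 NL _ Lf Lg); [over_tac | move=> v; prop_tac].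
Qed.

Lemma representable_Neg phi : representable phi -> representable (Neg phi).
Proof. by move=> rphi; apply: representable_Imp => //; apply: representable_base. Qed.

Lemma representable_Or phi psi :
  representable phi -> representable psi -> representable (Or phi psi).
Proof. by move=> rphi rpsi; apply/representable_Imp/rpsi/representable_Neg. Qed.

Lemma representable_And phi psi :
  representable phi -> representable psi -> representable (And phi psi).
Proof.
by move=> rphi rpsi; apply/representable_Neg/representable_Imp/representable_Neg.
Qed.

Lemma over_subst_base alpha : over A alpha -> over (A :|: B)%SET (subst r alpha).
Proof. by move=> oa; apply: over_subst (sA oa) _ => i; apply/sB/(rP i).1. Qed.

(** The truth-functional context [F] lets the induction peel [alpha] apart
    without putting it into disjunctive normal form. *)
Lemma representable_Dia_context h alpha : h \in B ->
  over A alpha -> vars_below n alpha ->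
  forall F : form M -> form M,
  (forall phi, over (A :|: B)%SET phi -> over (A :|: B)%SET (F phi)) ->
  (forall v phi psi, bool_eval v phi = bool_eval v psi ->
    bool_eval v (F phi) = bool_eval v (F psi)) ->
  (forall beta, over B beta -> vars_below k beta ->
    representable (Dia h (F beta))) ->
  representable (Dia h (F (subst r alpha))).
Proof.
move=> hB; elim: alpha => [i _ _|_ _|f IHf g IHg|a f _] /=.
- by move=> F _ _; apply; case: (rP i).
- by move=> F _ _; apply.
- move=> /andP[of_ og] /andP[vf vg] F FO FE FB.
  have [osf osg] := (over_subst_base of_, over_subst_base og).
  (* The two sides of the implication are traded for [B]-formulas one after the other, the other
     side being absorbed into the context. *)
  apply: (IHf of_ vf (fun x => F (Imp x (subst r g)))) => [phi ophi|v phi psi e|b ob vb].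
  + by apply: FO; rewrite overE ophi.
  + by apply: FE; rewrite !evalE e.
  apply: (IHg og vg (fun x => F (Imp b x))) => [phi ophi|v phi psi e|c oc vc].
  + by apply: FO; rewrite overE ophi sB.
  + by apply: FE; rewrite !evalE e.
  by apply: FB; rewrite /= ?ob ?vb.
- move=> /andP[aA of_] vf F FO FE FB.
  set d := Dia a (subst r f).
  have osf := over_subst_base of_.
  have od : over (A :|: B)%SET d by rewrite /= finset.in_setU aA.
  have rd : representable d.
    exists (Dia a f); split=> //; first by rewrite /= aA.
    exact: (Iff_refl NL od).
  (* Shannon expansion of the context at [d]. After the split only [F (Top M)] and [F Bot] remain
     under [Dia h], and [FB] covers both. *)
  have Ls : L (Iff (F d) (Or (And d (F (Top M))) (And (Neg d) (F Bot)))).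
    apply: (logic_taut NL) => [|v]; first by rewrite !overE !FO // od.
    rewrite !evalE; case vd: (bool_eval v d) => /=.
      by rewrite orbF; apply/eqP/FE.
    by apply/eqP/FE.
  apply: (representable_congr (Dia_sum_split aA hB osf Ls)).
  apply: representable_Or; apply: representable_And => //; try exact: FB.
  exact: representable_Neg.
Qed.

Lemma representableT phi :
  over (A :|: B)%SET phi -> vars_below k phi -> representable phi.
Proof.
elim: phi => [i|_ _|f IHf g IHg|a f IHf].
- by move=> _; apply: representable_base.
- exact: representable_base.
- by move=> /andP[/IHf rf /IHg rg] /andP[/rf ? /rg ?]; apply: representable_Imp.
move=> /andP[aAB of_] vf; have [alpha [oa va La]] := IHf of_ vf.
apply: (representable_congr (Dia_congr NL aAB La)).
move: aAB; rewrite finset.in_setU => /orP[aA|aB].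
  exists (Dia a alpha); split=> //; first by rewrite /= aA.
  apply: (Iff_refl NL); rewrite [over _ _]/= finset.in_setU aA; exact: over_subst_base.
apply: (@representable_Dia_context a alpha aB oa va id) => // b ob vb.
by apply: representable_base => //=; rewrite aB.
Qed.

End NormalForm.

(** The number [n] of representatives for [B] in [k] variables becomes the number of variables for
    [A]; composing the two lists represents every formula in [k] variables. *)
Lemma locally_tabular_sum :
  locally_tabular A (restriction A L) -> locally_tabular B (restriction B L) ->
  locally_tabular (A :|: B)%SET L.
Proof.
move=> ltA ltB k.
have NA := restriction_normal NL (finset.subsetUl A B).
have NB := restriction_normal NL (finset.subsetUr A B).
have /(k_finiteP _ NB)[n [r [rP rE]]] := ltB k.
have /(k_finiteP _ NA)[n' [r' [rP' rE']]] := ltA n.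
apply/(k_finiteP _ NL); exists n', (fun i => subst r (r' i)); split=> [i|phi ophi vphi].
  split; first by apply: (over_subst_base rP); case: (rP' i).
  by apply: vars_below_subst => j; case: (rP j).
have [alpha [oa va La]] := representableT rP rE ophi vphi.
have [i lti [Li _]] := rE' _ oa va; exists i => //; apply: (Iff_trans NL La).
by apply: (normal_subst NL _ Li) => j; apply/sB/(rP j).1.
Qed.

End LogicSum.

Theorem theorem5p14 (M : finType) (A B : {set M}) (L1 L2 : set (form M))
    (disjAB : [disjoint A & B])
    (normal1 : normal_logic A L1) (normal2 : normal_logic B L2)
    (canonical1 : canonical_logic A L1) (canonical2 : canonical_logic B L2)
    (fhc1 : finite_height_criterion A L1)
    (fhc2 : finite_height_criterion B L2) :
  finite_height_criterion (A :|: B)%SET (logic_sum A B L1 L2).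
Proof.
move=> L [NL sL].
have subL : (L1 `|` L2 `|` sum_axioms A B `<=` L)%classic.
  by apply: subset_trans sL; apply: sub_smallest.
(* A fragment of a fragment is a fragment of [L], so the assumed finite heights are those that each
   summand's criterion asks for. *)
have restr (C C' : {set M}) : C \subset C' -> restriction C (restriction C' L) = restriction C L.
  move=> sC; apply/seteqP; split=> phi [Lphi oC]; first by split=> //; case: Lphi.
  by split=> //; split=> //; apply: over_subset oC.
split=> [ltL C sC|hL].
  apply: locally_tabular_height (restriction_normal NL sC) _ => k.
  exact: (k_finite_restriction NL sC (ltL k)).
have ltX (X : {set M}) LX : finite_height_criterion X LX -> normal_logic X LX ->
    X \subset (A :|: B)%SET -> (LX `<=` L)%classic ->
    locally_tabular X (restriction X L).
  move=> fhc NX sX LXL; apply/fhc.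
    split; first exact: (restriction_normal NL sX).
    by move=> phi LXphi; split; [apply: LXL | apply: (normal_over NX)].
  by move=> C sC; rewrite restr //; apply/hL/(fintype.subset_trans sC).
apply: locally_tabular_sum => //.
- by move=> phi ax; apply: subL; right.
- apply: (ltX _ L1) => // [|phi L1phi]; [exact: finset.subsetUl|].
  by apply: subL; left; left.
- apply: (ltX _ L2) => // [|phi L2phi]; [exact: finset.subsetUr|].
  by apply: subL; left; right.
Qed.
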